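(* Let $\Xi$ be a simple point process on $\mathcal X$ with distribution $P$ satisfying $$\mathbb P\bigl(\Xi(B)=0\mid \Xi|_{B^c}\bigr)>0\ \text{ a.s. for every } B\in\hat{\mathcal B},$$ with Papangelou kernel $L$, and let $Q$ be an edge kernel. Let $\tilde Q_1$ and $\tilde Q_{2|1}$ be the kernels obtained from $Q$ as described in the context. Then for any measurable function $h:\mathfrak N\times\mathfrak N_2\times\mathcal X\times\mathfrak N_2\to\mathbb R_+$ we have $$\begin{aligned} &\int_{\mathfrak N\times\mathfrak N_2}\int_{\mathcal X} h\bigl(\xi-\delta_x,\ \sigma|_{(\xi-\delta_x)^{\langle2\rangle}},\ x,\ \sigma|_{\langle\xi-\delta_x,x\rangle}\bigr)\,\xi(dx)\,(P\otimes Q)(d(\xi,\sigma))\\ &=\int_{\mathfrak N\times\mathfrak N_2}\int_{\mathcal X}\int_{\mathfrak N_2} h(\xi,\sigma,x,\sigma_2)\,\tilde Q_{2|1}(\xi,x,\sigma;d\sigma_2)\,L(dx\mid\xi)\,(P\otimes Q)(d(\xi,\sigma))\\ &\quad+\int_{\mathfrak N}\int_{\mathcal X}\int_{\mathfrak N_2}\int_{\mathfrak N_2} h(\xi,\sigma_1,x,\sigma_2)\,\tilde Q_{2|1}(\xi,x,\sigma_1;d\sigma_2)\,\bigl(\tilde Q_1(\xi,x;d\sigma_1)-Q(\xi,d\sigma_1)\bigr)\,L(dx\mid\xi)\,P(d\xi). \end{aligned}$$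
   Context: $(\mathcal X,\hat{\mathcal B},\mathcal B)$ is a localised Borel space: $\mathcal B$ is the $\sigma$-algebra on $\mathcal X$ and $\hat{\mathcal B}\subset\mathcal B$ the localising ring of ''bounded'' sets (e.g. $\mathcal X$ a complete separable metric space with its Borel sets and bounded Borel sets). $\mathfrak N$ is the space of simple (multi-point free) counting measures on $\mathcal X$ that are finite on all $B\in\hat{\mathcal B}$; $\xi\in\mathfrak N$ is identified with its support. For $A\subset\mathcal X$ and $x\in\mathcal X\setminus A$ let $A^{\langle2\rangle}=\{\{y,z\}\subset A: y\ne z\}$ and $\langle A,x\rangle=\{\{y,x\}: y\in A\}$. $\mathfrak N_2$ is the space of simple counting measures on $\mathcal X^{\langle2\rangle}$ that are finite on $B^{\langle 2\rangle}$ for $B\in\hat{\mathcal B}$. $\mathfrak N$ and $\mathfrak N_2$ carry the smallest $\sigma$-algebras $\mathcal N,\mathcal N_2$ making all point counts measurable. For $C\subset\mathcal X^{\langle2\rangle}$, $\mathfrak N_2|_C=\{\sigma\in\mathfrak N_2:\sigma(C^c)=0\}$, and $\sigma|_C$ is the restriction of $\sigma$ to $C$. An edge kernel is a probability kernel $Q$ from $\mathfrak N$ to $\mathfrak N_2$ such that $Q(\xi,\cdot)$ is concentrated on $\mathfrak N_2|_{\xi^{\langle2\rangle}}$ for every $\xi$. $P\otimes Q$ is the distribution on $\mathfrak N\times\mathfrak N_2$ with $\int f\,d(P\otimes Q)=\int\int f(\xi,\sigma)\,Q(\xi,d\sigma)\,P(d\xi)$ for measurable $f\ge 0$. The Papangelou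 kernel $L$ of $\Xi$ is the $P$-a.s. unique kernel from $\mathfrak N$ to $\mathcal X$ with $\mathbb E\int_{\mathcal X} g(\Xi-\delta_x,x)\,\Xi(dx)=\mathbb E\int_{\mathcal X} g(\Xi,x)\,L(dx\mid\Xi)$ for all measurable $g:\mathfrak N\times\mathcal X\to\mathbb R_+$ (it exists under the assumed condition on $\Xi$). For $\xi\in\mathfrak N$ and $x\in\mathcal X\setminus\xi$, let $\tilde Q(\xi,x;\cdot)$ be the image of $Q(\xi+\delta_x;\cdot)$ under $\sigma\mapsto(\sigma|_{(\mathcal X\setminus\{x\})^{\langle2\rangle}},\sigma|_{\langle\mathcal X\setminus\{x\},x\rangle})$, a probability measure on $\mathfrak N_2\times\mathfrak N_2$. Let $\tilde Q_1(\xi,x;\cdot)=\tilde Q(\xi,x;\cdot\times\mathfrak N_2)$ be its first marginal, and let $\tilde Q_{2|1}$ be a probability kernel with $\tilde Q(\xi,x;d(\sigma_1,\sigma_2))=\tilde Q_{2|1}(\xi,x,\sigma_1;d\sigma_2)\,\tilde Q_1(\xi,x;d\sigma_1)$.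
   Formalization: The formula is stated for those h for which the right-hand side is meaningful: none of the integrals involving the signed measure Q̃₁−Q, nor the final sum of the two terms, is of the form ∞−∞; without this the right-hand side can be undefined. *)

(* Defs.v *)
From HB Require Import structures.
From mathcomp Require Import all_boot all_order all_algebra.
From mathcomp Require Import all_classical all_reals all_analysis.
From mathcomp Require Import measurable_realfun.

Set Implicit Arguments.
Unset Strict Implicit.
Unset Printing Implicit Defensive.

Import Order.TTheory GRing.Theory Num.Theory.
Import numFieldNormedType.Exports.

Local Open Scope classical_set_scope.
Local Open Scope ring_scope.
Local Open Scope ereal_scope.

(* An injective measurable map whose direct images of measurable sets are
   measurable is an isomorphism onto a Borel subset of the real line. *)
Record localised_borel d (R : realType) := LocalisedBorel {
  lb_sort :> measurableType d ;
  bounded : set (set lb_sort) ;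
  lb_borel : exists f : lb_sort -> R,
    [/\ measurable_fun setT f, injective f &
        forall A, measurable A -> measurable (f @` A)] ;
  bounded_measurable : bounded `<=` measurable ;
  bounded_setring : setring bounded ;
  bounded_setI : forall B C, bounded B -> measurable C -> bounded (B `&` C) ;
  bounded_exhaust : exists S : (set lb_sort)^nat,
    [/\ forall n, bounded (S n), nondecreasing_seq S, \bigcup_n S n = setT &
        forall B, bounded B -> exists n, B `<=` S n] }.

Section localised_borel_lemmas.
Context d (R : realType) (X : localised_borel d R).

Lemma lb_measurable_set1 (x : X) : measurable [set x].
Proof.
have [f [mf injf _]] := lb_borel X.
suff -> : [set x] = setT `&` f @^-1` [set f x] by exact: mf.
by rewrite setTI; apply/seteqP; split=> [y ->//|y /injf].
Qed.

Lemma lb_measurable_offdiag : measurable [set p : X * X | p.1 <> p.2].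
Proof.
have [f [mf injf _]] := lb_borel X.
have m1 : measurable_fun setT (fun p : X * X => f p.1).
  by apply: (measurableT_comp mf); exact: measurable_fst.
have m2 : measurable_fun setT (fun p : X * X => f p.2).
  by apply: (measurableT_comp mf); exact: measurable_snd.
have := measurable_fun_eqr m1 m2.
move=> /(_ measurableT [set false] I); rewrite setTI.
congr measurable.
apply/seteqP; split=> -[y z]/=.
  by move=> + yz; rewrite yz eqxx.
by move=> yz; apply/eqP => /injf.
Qed.

End localised_borel_lemmas.

Section configurations.
Context d (R : realType) (X : localised_borel d R).

(* A simple counting measure is identified with its support. *)
Record config := Config {
  support :> set X ;
  config_locally_finite : forall B, bounded B -> finite_set (support `&` B) }.

Lemma config_measurable (xi : config) : measurable (support xi).
Proof.
have [S [bS _ ST _]] := bounded_exhaust X.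
rewrite -[support xi]setIT -ST setI_bigcupr.
apply: bigcupT_measurable => n.
have fS := config_locally_finite xi (bS n).
rewrite -[X in measurable X]image_id -bigcup_imset1.
by apply: fin_bigcup_measurable => // x _; exact: lb_measurable_set1.
Qed.

Definition config_measure (xi : config) : set X -> \bar R :=
  mrestr (@counting X R) (config_measurable xi).
HB.instance Definition _ xi := Measure.on (config_measure xi).

Lemma config0_subproof B : bounded B -> finite_set ((set0 : set X) `&` B).
Proof. by rewrite set0I. Qed.
Definition config0 := Config config0_subproof.

HB.instance Definition _ := gen_eqMixin config.
HB.instance Definition _ := gen_choiceMixin config.
HB.instance Definition _ := isPointed.Build config config0.

Definition config_sigma_algebra : set (set config) :=
  <<s \bigcup_(B in @measurable d X)
        preimage_set_system setT (config_measure ^~ B) measurable >>.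

Let config_sigma0 : config_sigma_algebra set0.
Proof. exact: sigma_algebra0. Qed.

Let config_sigmaC A : config_sigma_algebra A -> config_sigma_algebra (~` A).
Proof. exact: sigma_algebraC. Qed.

Let config_sigmaU (F : (set config)^nat) :
  (forall i, config_sigma_algebra (F i)) ->
  config_sigma_algebra (\bigcup_i F i).
Proof. exact: sigma_algebra_bigcup. Qed.

Definition config_display : measure_display.
Proof. by constructor. Qed.

HB.instance Definition _ := @isMeasurable.Build config_display config
  config_sigma_algebra config_sigma0 config_sigmaC config_sigmaU.

Lemma add_point_subproof (xi : config) x B :
  bounded B -> finite_set ((x |` xi) `&` B).
Proof.
move=> bB; rewrite setIUl finite_setU; split.
  by apply: (@sub_finite_set _ _ [set x]) => //; exact: subIsetl.
exact: config_locally_finite.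
Qed.
(* This is xi + delta_x when x is not a point of xi, which is the only case in
   which the value matters. *)
Definition add_point (xi : config) x := Config (@add_point_subproof xi x).

Lemma config_restr_subproof (xi : config) A B :
  bounded B -> finite_set ((xi `&` A) `&` B).
Proof.
move=> bB; apply: sub_finite_set (config_locally_finite xi bB).
by rewrite setIAC; exact: subIsetl.
Qed.
Definition config_restr (xi : config) A := Config (@config_restr_subproof xi A).

(* xi - delta_x for a point x of xi. *)
Definition del_point (xi : config) x := config_restr xi (~` [set x]).

End configurations.
Arguments config {d R}.

Section edges.
Context d (R : realType) (X : localised_borel d R).
Implicit Types (A : set X) (x : X).

(* Unordered pairs are represented by two-element sets. *)
Definition pairs A : set (set X) :=
  [set e | exists y z, [/\ A y, A z, y <> z & e = [set y; z]]].

Definition star A x : set (set X) := [set [set y; x] | y in A].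

(* The sigma-algebra on unordered pairs is the quotient one: that of symmetric
   measurable sets of ordered pairs, off the diagonal. *)
Definition edge_measurable (C : set (set X)) :=
  C `<=` pairs setT /\
  measurable [set p : X * X | p.1 <> p.2 /\ C [set p.1; p.2]].

Record econfig := EConfig {
  edges :> set (set X) ;
  edges_pairs : edges `<=` pairs setT ;
  econfig_locally_finite : forall B, bounded B ->
    finite_set (edges `&` pairs B) }.

Definition edge_count (s : econfig) (C : set (set X)) : \bar R :=
  counting (s `&` C).

Lemma econfig0_subproof1 : (set0 : set (set X)) `<=` pairs setT.
Proof. exact: sub0set. Qed.
Lemma econfig0_subproof2 B : bounded B ->
  finite_set ((set0 : set (set X)) `&` pairs B).
Proof. by rewrite set0I. Qed.
Definition econfig0 := EConfig econfig0_subproof1 econfig0_subproof2.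

HB.instance Definition _ := gen_eqMixin econfig.
HB.instance Definition _ := gen_choiceMixin econfig.
HB.instance Definition _ := isPointed.Build econfig econfig0.

Definition econfig_sigma_algebra : set (set econfig) :=
  <<s \bigcup_(C in edge_measurable)
        preimage_set_system setT (edge_count ^~ C) measurable >>.

Let econfig_sigma0 : econfig_sigma_algebra set0.
Proof. exact: sigma_algebra0. Qed.

Let econfig_sigmaC U : econfig_sigma_algebra U -> econfig_sigma_algebra (~` U).
Proof. exact: sigma_algebraC. Qed.

Let econfig_sigmaU (F : (set econfig)^nat) :
  (forall i, econfig_sigma_algebra (F i)) ->
  econfig_sigma_algebra (\bigcup_i F i).
Proof. exact: sigma_algebra_bigcup. Qed.

Definition econfig_display : measure_display.
Proof. by constructor. Qed.

HB.instance Definition _ := @isMeasurable.Build econfig_display econfig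
  econfig_sigma_algebra econfig_sigma0 econfig_sigmaC econfig_sigmaU.

Lemma econfig_restr_subproof1 (s : econfig) C : s `&` C `<=` pairs setT.
Proof. by move=> e [se _]; exact: edges_pairs se. Qed.
Lemma econfig_restr_subproof2 (s : econfig) C B : bounded B ->
  finite_set ((s `&` C) `&` pairs B).
Proof.
move=> bB; apply: sub_finite_set (econfig_locally_finite s bB).
by rewrite setIAC; exact: subIsetl.
Qed.
Definition econfig_restr (s : econfig) C :=
  EConfig (@econfig_restr_subproof1 s C) (@econfig_restr_subproof2 s C).

Lemma measurable_edge_count C : edge_measurable C ->
  measurable_fun setT (edge_count ^~ C).
Proof.
move=> mC.
apply: (@measurability econfig_display _ econfig _ setT (edge_count ^~ C)
  measurable).
  by rewrite smallest_id//; exact: sigma_algebra_measurable.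
apply: subset_trans; last exact: sub_gen_smallest.
exact: (bigcup_sup mC).
Qed.

Lemma edge_measurableI C D : edge_measurable C -> edge_measurable D ->
  edge_measurable (C `&` D).
Proof.
move=> [CT mC] [_ mD]; split; first by move=> e [/CT].
rewrite (_ : [set _ | _] = [set p : X * X | p.1 <> p.2 /\ C [set p.1; p.2]] `&`
  [set p : X * X | p.1 <> p.2 /\ D [set p.1; p.2]]); first exact: measurableI.
by apply/seteqP; split=> p /=; tauto.
Qed.

Lemma measurable_econfig_restr C : edge_measurable C ->
  measurable_fun setT (econfig_restr ^~ C).
Proof.
move=> mC.
pose G : set_system econfig := \bigcup_(D in edge_measurable)
  preimage_set_system setT (edge_count ^~ D) measurable.
apply: (measurability G) => //= _ [_ [D mD [Y mY <-]] <-].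
suff -> : [set: econfig] `&`
    econfig_restr^~ C @^-1` ([set: econfig] `&` edge_count^~ D @^-1` Y) =
    [set: econfig] `&` edge_count^~ (C `&` D) @^-1` Y.
  exact: (measurable_edge_count (edge_measurableI mC mD)).
by rewrite !setTI; apply/seteqP; split=> s /=; rewrite /edge_count/= setIA.
Qed.

Lemma pair_set2 (a b y z : X) : [set a; b] = [set y; z] ->
  (a = y \/ a = z) /\ (b = y \/ b = z).
Proof.
move=> E; have : [set y; z] a by rewrite -E; left.
by have : [set y; z] b by rewrite -E; right.
Qed.

Lemma edge_measurable_pairs x : edge_measurable (pairs (~` [set x])).
Proof.
split; first by move=> e [y [z [_ _ yz ->]]]; exists y, z.
rewrite (_ : [set _ | _] =
    [set p : X * X | p.1 <> p.2] `&` ((~` [set x]) `*` (~` [set x]))).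
  apply: measurableI; first exact: lb_measurable_offdiag.
  by apply: measurableX; apply: measurableC; exact: lb_measurable_set1.
apply/seteqP; split=> -[a b]/=.
  move=> [ab [y [z [yx zx yz /pair_set2[ayz byz]]]]]; split => //; split=> ex.
    by case: ayz => e; [apply: yx|apply: zx]; rewrite -e.
  by case: byz => e; [apply: yx|apply: zx]; rewrite -e.
by move=> [ab [ax bx]]; split => //; exists a, b.
Qed.

Lemma edge_measurable_star x : edge_measurable (star (~` [set x]) x).
Proof.
split; first by move=> e [y yx <-]; exists y, x; split.
rewrite (_ : [set _ | _] = [set p : X * X | p.1 <> p.2] `&`
    (([set x] `*` setT) `|` (setT `*` [set x]))).
  apply: measurableI; first exact: lb_measurable_offdiag.
  by apply: measurableU; apply: measurableX => //; exact: lb_measurable_set1.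
apply/seteqP; split=> -[a b]/=.
  move=> [ab [y yx E]]; split => //.
  have : [set a; b] x by rewrite -E; right.
  by case=> ->; [left|right].
move=> [ab [[ax _]|[_ bx]]]; split => //.
  by exists b => [bx|]; [apply: ab; rewrite ax bx|rewrite ax setUC].
by exists a => [ax|]; [apply: ab; rewrite ax bx|rewrite bx].
Qed.

Definition split_at x (s : econfig) : econfig * econfig :=
  (econfig_restr s (pairs (~` [set x])),
   econfig_restr s (star (~` [set x]) x)).

Lemma measurable_split_at x : measurable_fun setT (split_at x).
Proof.
apply: measurable_fun_pair; apply: measurable_econfig_restr.
  exact: edge_measurable_pairs.
exact: edge_measurable_star.
Qed.

HB.instance Definition _ x :=
  isMeasurableFun.Build _ _ _ _ (split_at x) (measurable_split_at x).

End edges.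
Arguments econfig {d R}.

HB.instance Definition _ d d' (T : measurableType d) (T' : measurableType d') :=
  isMeasurableFun.Build _ _ _ _ (@fst T T') measurable_fst.

Section kernel_laws.
Context d d' (T : measurableType d) (T' : measurableType d') (R : realType).

Section kprob.
Variables (Q : R.-pker T ~> T') (t : T).
Definition kprob : set T' -> \bar R := Q t.
HB.instance Definition _ := Measure.on kprob.
HB.instance Definition _ :=
  Measure_isProbability.Build _ _ _ kprob (prob_kernel (s := Q) t).
End kprob.

Section semidirect.
Variables (P : probability T R) (Q : R.-pker T ~> T').

Definition semidirect (A : set (T * T')) : \bar R :=
  \int[P]_t Q t (xsection A t).

Let semidirect0 : semidirect set0 = 0.
Proof. by apply: integral0_eq => t _; rewrite xsection0 measure0. Qed.

Let semidirect_ge0 A : 0 <= semidirect A.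
Proof. by apply: integral_ge0 => t _; exact: measure_ge0. Qed.

Let semidirect_sigma_additive : semi_sigma_additive semidirect.
Proof.
move=> F mF tF mUF.
have mQ A : measurable A -> measurable_fun setT (fun t => Q t (xsection A t)).
  by move=> mA; exact: measurable_fun_xsection_finite_kernel (mem_set mA).
suff -> : semidirect (\bigcup_n F n) = \sum_(0 <= i <oo) semidirect (F i).
  by apply: is_cvg_nneseries => n _ _; exact: semidirect_ge0.
rewrite /semidirect -integral_nneseries//; last first.
  by move=> n; exact: mQ.
apply: eq_integral => t _; rewrite xsection_bigcup measure_semi_bigcup//.
- by move=> n; exact: measurable_xsection.
- exact: trivIset_xsection.
- by apply: bigcup_measurable => n _; exact: measurable_xsection.
Qed.

HB.instance Definition _ := isMeasure.Build _ _ _ semidirect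
  semidirect0 semidirect_ge0 semidirect_sigma_additive.

End semidirect.
End kernel_laws.

Section charge_integral.
Context d (T : measurableType d) (R : realType).

Definition cdiff (mu nu : probability T R) : {charge set T -> \bar R} :=
  cadd (charge_of_finite_measure mu) (copp (charge_of_finite_measure nu)).

Lemma hahn_pair_exists (nu : {charge set T -> \bar R}) :
  exists PN : set T * set T, hahn_decomposition nu PN.1 PN.2.
Proof. by have [P [N PN]] := Hahn_decomposition nu; exists (P, N). Qed.

Definition hahn_pair (nu : {charge set T -> \bar R}) := cid (hahn_pair_exists nu).

(* On measurable sets, the Jordan decomposition does not depend on the chosen
   Hahn decomposition. *)
Definition charge_pos (nu : {charge set T -> \bar R})
  : {measure set T -> \bar R} := jordan_pos (svalP (hahn_pair nu)).
Definition charge_neg (nu : {charge set T -> \bar R})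
  : {measure set T -> \bar R} := jordan_neg (svalP (hahn_pair nu)).

(* Integral of a nonnegative function against a signed measure. It is
   meaningful if the two integrals are not both infinite. *)
Definition charge_integral (nu : {charge set T -> \bar R}) (f : T -> \bar R) :=
  \int[charge_pos nu]_t f t - \int[charge_neg nu]_t f t.

Definition charge_integral_defined (nu : {charge set T -> \bar R})
    (f : T -> \bar R) : bool :=
  \int[charge_pos nu]_t f t +? - \int[charge_neg nu]_t f t.

(* The library integral of f is the difference of the integrals of the positive
   and the negative parts of f, even if both are infinite. *)
Definition integral_defined (mu : {measure set T -> \bar R})
    (f : T -> \bar R) : bool :=
  \int[mu]_t f^\+ t +? - \int[mu]_t f^\- t.

End charge_integral.

(* Z is a version of the conditional probability of E given Y. *)
Definition is_cond_prob d d' (W : measurableType d) (T : measurableType d')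
    (R : realType) (Pr : probability W R) (E : set W) (Y : W -> T)
    (Z : W -> R) :=
  [/\ forall w, (0 <= Z w)%R,
      forall V, measurable V -> g_sigma_algebra_preimage Y (Z @^-1` V) &
      forall A, g_sigma_algebra_preimage Y A ->
        \int[Pr]_(w in A) (Z w)%:E = Pr (E `&` A)].

Section random_graphs.
Context d dW (R : realType) (X : localised_borel d R) (W : measurableType dW)
  (Pr : probability W R).
Implicit Types (Xi : {RV Pr >-> config X}) (Q : R.-pker config X ~> econfig X).

(* Conditional probabilities being unique almost surely, the choice of the
   version is immaterial. *)
Definition positive_void_probabilities Xi :=
  forall B, bounded B -> exists2 Z,
    is_cond_prob Pr [set w | config_measure (Xi w) B = 0]
      (fun w => config_restr (Xi w) (~` B)) Z &
    {ae Pr, forall w, (0 < Z w)%R}.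

Definition is_papangelou Xi (L : R.-ker config X ~> X) :=
  forall g : config X * X -> R, measurable_fun setT g ->
    (forall u, (0 <= g u)%R) ->
    \int[Pr]_w \int[config_measure (Xi w)]_x (g (del_point (Xi w) x, x))%:E =
    \int[Pr]_w \int[L (Xi w)]_x (g (Xi w, x))%:E.

Definition is_edge_kernel Q :=
  forall xi, {ae Q xi, forall s, edges s `<=` pairs (support xi)}.

Definition split_law Q (xi : config X) (x : X)
    : probability (econfig X * econfig X)%type R :=
  distribution (kprob Q (add_point xi x)) (split_at x).

Definition split_law1 Q (xi : config X) (x : X) : probability (econfig X) R :=
  distribution (split_law Q xi x) fst.

(* The conditional kernel is total, but only constrained at pairs (xi, x) with x
   outside of xi. *)
Definition is_split_disintegration Q
    (Q21 : R.-pker (config X * X * econfig X) ~> econfig X) :=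
  forall xi x, ~ support xi x -> forall A, measurable A ->
    split_law Q xi x A =
    \int[split_law1 Q xi x]_s Q21 (xi, x, s) (xsection A s).

End random_graphs.

(* Main.v *)
(** Write [A (xi, x)] and [B (xi, x)] for the integrals of [f xi x] against
    Qtilde_1(xi, x; .) and Q(xi, .). Since Q(xi, .) only charges edges between
    points of xi, restricting to the pairs of xi - delta_x, or to its star at x,
    amounts to splitting the edges at x; so Fubini and the disintegration of
    Qtilde turn the left-hand side into the expectation of the sum over x in Xi
    of [A (Xi - delta_x, x)], which is P L A by the definition of L. The
    right-hand side is P L B + P L (A - B).

    The measures [L xi] need not be sigma-finite, but they are locally finite
    for almost every xi, so that L can be replaced by an s-finite kernel. The
    inner integral against the signed measure is [A - B] unless [A] and [B] are
    both infinite, where it depends on Hahn decompositions chosen separately for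
    each (xi, x), and may fail to be measurable. This is harmless: if P L A or
    P L B is finite, such (xi, x) are negligible, and otherwise both sides are
    infinite, the sum on the right being defined. Hence integrals of functions
    that are equal almost everywhere have to be compared without assuming
    measurability. *)
Require Import Defs.
From HB Require Import structures.
From mathcomp Require Import all_boot all_order all_algebra.
From mathcomp Require Import all_classical all_reals all_analysis.
From mathcomp Require Import measurable_realfun.
From mathcomp Require Import ring.

Set Implicit Arguments.
Unset Strict Implicit.
Unset Printing Implicit Defensive.

Import Order.TTheory GRing.Theory Num.Theory.
Import numFieldNormedType.Exports.

Local Open Scope classical_set_scope.
Local Open Scope ring_scope.
Local Open Scope ereal_scope.

(** * Integrals of possibly non-measurable functions, and differences of integrals *)

Section ae_integral.
Context d (T : measurableType d) (R : realType).
Variable mu : {measure set T -> \bar R}.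
Implicit Types f g : T -> \bar R.
Import HBNNSimple.

(** The integral of a nonnegative function, measurable or not, is a supremum over the simple
    functions below it. Setting a simple function below [f] to zero on the exceptional null set
    keeps its integral and puts it below [g]. *)
Lemma ge0_ae_le_integral f g : (forall x, 0 <= f x) -> (forall x, 0 <= g x) ->
  {ae mu, forall x, f x <= g x} -> \int[mu]_x f x <= \int[mu]_x g x.
Proof.
move=> f0 g0 [N [mN N0 Nfg]].
rewrite !ge0_integralTE//; apply: ge_ereal_sup => _ [h /= hf <-].
have mNC : measurable (~` N) by exact: measurableC.
apply: ereal_sup_ubound; exists (proj_nnsfun h mNC) => [x /=|].
  have [xN|xN] := pselect (N x).
    by rewrite mindicE memNset ?mulr0//=; apply.
  rewrite mindicE mem_set// mulr1 (le_trans (hf x))//.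
  by apply: contrapT => fg; apply: xN; apply: Nfg.
rewrite -!integralT_nnsfun; apply: ge0_ae_eq_integral => //.
- exact/measurable_EFinP.
- exact/measurable_EFinP.
- by move=> x _; rewrite lee_fin.
- by move=> x _; rewrite lee_fin.
exists N; split => // x /= xN; apply: contrapT => nN; apply: xN => _.
by rewrite mindicE mem_set// mulr1.
Qed.

Lemma ae_integral_eq f g :
  {ae mu, forall x, f x = g x} -> \int[mu]_x f x = \int[mu]_x g x.
Proof.
move=> [N [mN N0 Nfg]].
have H (p q : T -> \bar R) : (forall x, 0 <= p x) -> (forall x, 0 <= q x) ->
    (forall x, ~ N x -> p x = q x) -> \int[mu]_x p x = \int[mu]_x q x.
  move=> p0 q0 pq; apply/eqP; rewrite eq_le; apply/andP; split.
    apply: ge0_ae_le_integral => //; exists N; split => // x /= xpq.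
    by apply: contrapT => /pq pqx; apply: xpq; rewrite pqx.
  apply: ge0_ae_le_integral => //; exists N; split => // x /= xpq.
  by apply: contrapT => /pq pqx; apply: xpq; rewrite pqx.
have fg x : ~ N x -> f x = g x.
  by move=> xN; apply: contrapT => fgx; apply: xN; exact: Nfg.
rewrite integralE [RHS]integralE; congr (_ - _); apply: H => // x /fg.
  by rewrite !funeposE => ->.
by rewrite !funenegE => ->.
Qed.

End ae_integral.

(** Meant for [u] and [v] arising as positive and negative parts of a difference, with majorants [a]
    and [b]. If [a] or [b] is finite, so is [u] or [v], and no form +oo - oo occurs. *)
Lemma sube_of_adde_eq (R : realDomainType) (a b u v : \bar R) :
  0 <= a -> 0 <= b -> 0 <= u -> 0 <= v -> a + v = b + u -> u <= a -> v <= b ->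
  a < +oo \/ b < +oo -> u - v = a - b.
Proof.
case: a => [a||]//; case: b => [b||]//; case: u => [u||]//; case: v => [v||]//;
  rewrite ?lee_fin//= ?leye_eq//.
- move=> _ _ _ _ [] h _ _ _; rewrite -!EFinB; congr (_%:E).
  have -> : a = (b + u - v)%R by rewrite -h addrK.
  by ring.
- by move=> _ _ _ _ _ _ _ [].
- by move=> _ _ _ _ _ _ _ [].
Qed.

Section integral_difference.
Context d (T : measurableType d) (R : realType).
Variable mu : {measure set T -> \bar R}.
Implicit Types A B C : T -> \bar R.

(* With [C = A - B], the identity [A + C^- = B + C^+] also holds where [A] and
   [B] are both infinite, whatever the value of [C] there. *)
Lemma ge0_integralB A B : measurable_fun setT A -> measurable_fun setT B ->
  (forall x, 0 <= A x) -> (forall x, 0 <= B x) ->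
  \int[mu]_x A x < +oo \/ \int[mu]_x B x < +oo ->
  \int[mu]_x (A x - B x) = \int[mu]_x A x - \int[mu]_x B x.
Proof.
move=> mA mB A0 B0 AB.
have mC : measurable_fun setT (A \- B) by exact: emeasurable_funB.
have CA x : (A \- B)^\+ x <= A x.
  rewrite funeposE ge_max A0 andbT/=; have := A0 x; have := B0 x.
  case: (A x) => [a||]//; case: (B x) => [b||]//=; rewrite ?lee_fin// => b0 a0.
    by rewrite gerBl.
  by rewrite addeNy leNye.
have CB x : (A \- B)^\- x <= B x.
  rewrite funenegE ge_max B0 andbT/=; have := A0 x; have := B0 x.
  case: (A x) => [a||]//; case: (B x) => [b||]//=; rewrite ?lee_fin// => b0 a0.
    by rewrite opprB gerBl.
  by rewrite leNye.
rewrite integralE; apply: sube_of_adde_eq => //; try exact: integral_ge0.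
- rewrite -!ge0_integralD//; last 2 first.
  + exact: measurable_funepos.
  + exact: measurable_funeneg.
  apply: eq_integral => x _; rewrite funeposE funenegE.
  have := A0 x; have := B0 x.
  case: (A x) => [a||]//; case: (B x) => [b||]//=; rewrite ?lee_fin// => b0 a0.
  + by rewrite -!EFinB -!EFin_max -!EFinD; congr (_%:E); case: (leP a b) => ab;
    [rewrite (@max_r _ _ (a - b)%R) ?subr_le0// max_l ?opprB ?subr_ge0//
    |rewrite (@max_l _ _ (a - b)%R) ?subr_ge0 1?ltW//
      max_r ?opprB ?subr_le0 1?ltW//]; rewrite addr0 addrC subrK.
  + by rewrite addeNy maxye maxNye addey// addye.
  + by rewrite maxNye adde0 [_ + (- b)%:E]addye// maxye addey.
  + by rewrite addeNy maxye maxNye addey.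
- apply: ge0_le_integral => //; exact: measurable_funepos.
- apply: ge0_le_integral => //; exact: measurable_funeneg.
Qed.

(** Finiteness of one of the two integrals makes [A] or [B] finite almost everywhere, so that [C]
    agrees with [A - B] almost everywhere; [ae_integral_eq] then copes with a non-measurable [C]. *)
Lemma ge0_integralB_ae A B C :
  measurable_fun setT A -> measurable_fun setT B ->
  (forall x, 0 <= A x) -> (forall x, 0 <= B x) ->
  {ae mu, forall x, A x < +oo \/ B x < +oo -> C x = A x - B x} ->
  \int[mu]_x A x < +oo \/ \int[mu]_x B x < +oo ->
  \int[mu]_x C x = \int[mu]_x A x - \int[mu]_x B x.
Proof.
move=> mA mB A0 B0 CAB AB; rewrite -ge0_integralB//; apply: ae_integral_eq.
have fin D : measurable_fun setT D -> (forall x, 0 <= D x) ->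
    \int[mu]_x D x < +oo -> {ae mu, forall x, D x < +oo}.
  move=> mD D0 iD.
  have : mu.-integrable setT D.
    by apply/integrableP; split => //; under eq_integral do rewrite gee0_abs//.
  move=> /(integrable_ae measurableT); apply: filterS => x /(_ I).
  by rewrite ge0_fin_numE.
case: AB => [/(fin _ mA A0)|/(fin _ mB B0)]; apply: filterS2 CAB => x h ?;
  by apply: h; auto.
Qed.

End integral_difference.

Section charge_integral_difference.
Context d (T : measurableType d) (R : realType).
Variables mu nu : probability T R.

(** The Jordan parts of [mu - nu] are dominated by [mu] and [nu], and [mu] plus the negative part
    equals [nu] plus the positive part; integrating [f] gives the hypotheses of
    [sube_of_adde_eq]. *)
Lemma charge_integral_cdiff (f : T -> \bar R) : measurable_fun setT f ->
  (forall x, 0 <= f x) -> \int[mu]_x f x < +oo \/ \int[nu]_x f x < +oo ->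
  charge_integral (cdiff mu nu) f = \int[mu]_x f x - \int[nu]_x f x.
Proof.
move=> mf f0 fin; rewrite /charge_integral.
set D := cdiff mu nu.
have PN := svalP (hahn_pair D); set P := (sval (hahn_pair D)).1 in PN.
set N := (sval (hahn_pair D)).2 in PN.
have [[mP posP] [mN negN] PNT PN0] := PN.
have DE A : measurable A -> D A = mu A - nu A.
  by move=> mA; rewrite /D /cdiff /= /cadd/= /copp/=.
(* The Jordan parts unfold to a case distinction, with value 0 on non-measurable sets. *)
have posE A : measurable A -> charge_pos D A = D (A `&` P).
  move=> mA; transitivity (if A \in measurable then D (A `&` P) else 0) => //.
  by rewrite mem_set.
have negE A : measurable A -> charge_neg D A = - D (A `&` N).
  move=> mA.
  transitivity ((-1)%:E * if A \in measurable then D (A `&` N) else 0) => //.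
  by rewrite mem_set// EFinN mulN1e.
have mAP A : measurable A -> measurable (A `&` P).
  by move=> mA; exact: measurableI.
have mAN A : measurable A -> measurable (A `&` N).
  by move=> mA; exact: measurableI.
have split m (A : set T) : measurable A ->
    (m : probability T R) A = m (A `&` P) + m (A `&` N).
  move=> mA; rewrite -measureU//; [|exact: mAP|exact: mAN|].
    by rewrite -setIUr PNT setIT.
  by rewrite setIACA PN0 setI0.
have finm (m : probability T R) A : measurable A -> m A \is a fin_num.
  by move=> mA; exact: fin_num_measure.
apply: sube_of_adde_eq => //; try by apply: integral_ge0.
- rewrite -!ge0_integral_measure_add//.
  apply: eq_measure_integral => A mA _.
  (* Both sums equal [mu (A]&[P) + nu (A]&[N)]. *)
  transitivity (mu A + charge_neg D A); first exact: measure_addE.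
  transitivity (nu A + charge_pos D A); last by rewrite -measure_addE.
  rewrite posE// negE// !DE; [|exact: mAP|exact: mAN].
  rewrite (split mu A)// (split nu A)//.
  have := finm mu _ (mAP _ mA); have := finm mu _ (mAN _ mA).
  have := finm nu _ (mAP _ mA); have := finm nu _ (mAN _ mA).
  move: (mu _) (mu _) (nu _) (nu _) => [a||]// [b||]// [c||]// [e||]// _ _ _ _.
  by rewrite -!EFinB -!EFinD; congr (_%:E); ring.
- apply: ge0_le_measure_integral => // A mA; rewrite posE// DE; last exact: mAP.
  rewrite leeBlDr ?finm//; last exact: mAP.
  apply: (@le_trans _ _ (mu A)); last by rewrite leeDl.
  by apply: le_measure; rewrite ?inE//; exact: mAP.
- apply: ge0_le_measure_integral => // A mA; rewrite negE// DE; last exact: mAN.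
  rewrite fin_num_oppeB ?finm//; last exact: mAN.
  rewrite addeC leeBlDr ?finm//; last exact: mAN.
  apply: (@le_trans _ _ (nu A)); last by rewrite leeDl.
  by apply: le_measure; rewrite ?inE//; exact: mAN.
Qed.

End charge_integral_difference.

(** * Precomposition, mixture and disintegration of kernels *)

Section kernel_precomposition.
Context d d1 d2 (T : measurableType d) (S : measurableType d1)
  (Y : measurableType d2) (R : realType).
Variables (phi : T -> S) (mphi : measurable_fun setT phi).

(** The proof of measurability is an argument so that the kernel instances below can recover it from
    the term [kprecomp mphi k]. *)
Definition kprecomp of measurable_fun setT phi :=
  fun (k : S -> {measure set Y -> \bar R}) t => k (phi t).

Section kernel.
Variable k : R.-ker S ~> Y.

Let measurable_kprecomp U : measurable U ->
  measurable_fun setT (kprecomp mphi k ^~ U).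
Proof.
by move=> mU; exact: (measurableT_comp (measurable_kernel k U mU) mphi).
Qed.

HB.instance Definition _ :=
  isKernel.Build _ _ _ _ _ (kprecomp mphi k) measurable_kprecomp.
End kernel.

Variable k : R.-sfker S ~> Y.

Let sfinite_kprecomp : exists2 s : (R.-ker T ~> Y)^nat,
  forall n, measure_fam_uub (s n) &
  forall x U, measurable U -> kprecomp mphi k x U = kseries s x U.
Proof.
have [s ks] := sfinite_kernel k; exists (fun n => kprecomp mphi (s n)).
  by move=> n; have [r sr] := measure_uub (s n); exists r => t; exact: sr.
by move=> t U mU; rewrite /kprecomp ks.
Qed.

HB.instance Definition _ :=
  isSFiniteKernel_subdef.Build _ _ _ _ R (kprecomp mphi k) sfinite_kprecomp.

End kernel_precomposition.

Lemma measurable_fun_integral_kprecomp d d1 d2 (T : measurableType d)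
    (S : measurableType d1) (Y : measurableType d2) (R : realType)
    (k : R.-sfker S ~> Y) (phi : T -> S) (g : T * Y -> \bar R) :
  measurable_fun setT phi -> (forall z, 0 <= g z) -> measurable_fun setT g ->
  measurable_fun setT (fun t => \int[k (phi t)]_y g (t, y)).
Proof.
move=> mphi g0 mg.
exact: (measurable_fun_integral_sfinite_kernel g (kprecomp mphi k)).
Qed.

Lemma measurable_kernel_xsection d d1 d2 (T : measurableType d)
    (S : measurableType d1) (Y : measurableType d2) (R : realType)
    (k : R.-sfker S ~> Y) (phi : T -> S) (A : set (T * Y)) :
  measurable_fun setT phi -> measurable A ->
  measurable_fun setT (fun t => k (phi t) [set y | A (t, y)]).
Proof.
move=> mphi mA.
pose g (z : T * Y) : \bar R := (\1_A z)%:E.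
rewrite (_ : (fun t => _) = fun t => \int[k (phi t)]_y g (t, y)).
  apply: measurable_fun_integral_kprecomp => //.
  - by move=> z; rewrite lee_fin.
  - exact/measurable_EFinP.
apply/funext => t; rewrite -[X in k _ X]setIT -integral_indic//.
by have := measurable_xsection t mA; rewrite xsectionE.
Qed.

Section mixture.
Context d d1 d2 (T : measurableType d) (Y : measurableType d1)
  (Z : measurableType d2) (R : realType).

(** [M] is the image of P(dt) k(t, dy) under [psi]. It is built as a composition of kernels, so that
    s-finiteness of [k] suffices. *)
Lemma mixture_exists (P : probability T R) (k : R.-sfker T ~> Y)
    (psi : T * Y -> Z) : measurable_fun setT psi ->
  exists M : {measure set Z -> \bar R}, forall F : Z -> \bar R,
    (forall z, 0 <= F z) -> measurable_fun setT F ->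
    \int[M]_z F z = \int[P]_t \int[k t]_y F (psi (t, y)).
Proof.
move=> mpsi.
have msnd : measurable_fun setT (@snd unit T) by exact: measurable_snd.
(* [P] enters as a kernel from [unit], and in a composition the second kernel also depends on the
   source of the first; this explains the dummy component. *)
pose psi' (z : (unit * T) * Y) := psi (z.1.2, z.2).
have mpsi' : measurable_fun setT psi'.
  apply: (measurableT_comp mpsi); apply: measurable_fun_pair => //.
  exact: measurableT_comp.
pose l := kprobability (@measurable_cst _ _ unit (pprobability T R) setT P).
exists ((l \; (kprecomp msnd k \; kdirac mpsi')) tt) => F F0 mF.
rewrite integral_kcomp//; apply: eq_integral => t _.
rewrite integral_kcomp//; apply: eq_integral => y _.
by rewrite integral_dirac// diracT mul1e.
Qed.

End mixture.

(** Each side is the integral of [F] against one measure on [Z], and two measures that agree on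
    measurable sets have the same integrals. Indicators thus suffice, without any finiteness. *)
Lemma eq_mixture d d1 d2 d3 d4 (T : measurableType d) (Y : measurableType d1)
    (T' : measurableType d2) (Y' : measurableType d3) (Z : measurableType d4)
    (R : realType) (P : probability T R) (k : R.-sfker T ~> Y)
    (P' : probability T' R) (k' : R.-sfker T' ~> Y')
    (psi : T * Y -> Z) (psi' : T' * Y' -> Z) (F : Z -> \bar R) :
  measurable_fun setT psi -> measurable_fun setT psi' ->
  (forall A, measurable A -> \int[P]_t \int[k t]_y (\1_A (psi (t, y)))%:E =
    \int[P']_t \int[k' t]_y (\1_A (psi' (t, y)))%:E) ->
  (forall z, 0 <= F z) -> measurable_fun setT F ->
  \int[P]_t \int[k t]_y F (psi (t, y)) =
  \int[P']_t \int[k' t]_y F (psi' (t, y)).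
Proof.
move=> mpsi mpsi' E F0 mF.
have [M ME] := mixture_exists P k mpsi.
have [M' ME'] := mixture_exists P' k' mpsi'.
rewrite -ME// -ME'//; apply: eq_measure_integral => A mA _.
rewrite -[A]setIT -!integral_indic// ME ?ME'//.
- exact: E.
- exact/measurable_EFinP.
- exact/measurable_EFinP.
Qed.

Lemma integral_disintegration d d1 (T : measurableType d)
    (Y : measurableType d1) (R : realType) (mu : {measure set (T * Y) -> \bar R})
    (P : probability T R) (k : R.-sfker T ~> Y) (F : T * Y -> \bar R) :
  (forall A, measurable A -> mu A = \int[P]_t k t (xsection A t)) ->
  (forall z, 0 <= F z) -> measurable_fun setT F ->
  \int[mu]_z F z = \int[P]_t \int[k t]_y F (t, y).
Proof.
move=> muE F0 mF.
have [M ME] := mixture_exists P k (@measurable_id _ (T * Y)%type setT).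
rewrite -ME//; apply: eq_measure_integral => A mA _.
rewrite -[A in RHS]setIT -integral_indic// ME.
- rewrite muE//; apply: eq_integral => t _.
  rewrite -[X in k _ X]setIT -integral_indic//; last exact: measurable_xsection.
  by apply: eq_integral => y _; rewrite !indicE mem_xsection.
- by move=> z; rewrite lee_fin.
- exact/measurable_EFinP.
Qed.

(** * S-finite versions of kernels *)

Section sfinite_cutoff.
Context d d1 (T : measurableType d) (Y : measurableType d1) (R : realType).
Variable k : R.-ker T ~> Y.

Section level.
Variables (D : set Y) (mD : measurable D) (j : nat).

Let level t := j%:R%:E <= k t D < j.+1%:R%:E.

(** Selecting [t] by the value of [k t D] bounds the total mass by [j + 1] uniformly in [t], which
    makes [klevel] a finite kernel. *)
Definition klevel (t : T) : {measure set Y -> \bar R} :=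
  if level t then (mrestr (k t) mD : {measure set Y -> \bar R}) else mzero.

Let measurable_klevel U : measurable U -> measurable_fun setT (klevel ^~ U).
Proof.
move=> mU.
have mk V : measurable V -> measurable_fun setT (k ^~ V).
  exact: measurable_kernel.
rewrite (_ : klevel ^~ U = fun t => if level t then k t (U `&` D) else 0).
  apply: measurable_fun_ifT => //; last by apply: mk; exact: measurableI.
  apply: measurable_and; first by apply: measurable_fun_lee => //; exact: mk.
  by apply: measurable_fun_lte => //; exact: mk.
by apply/funext => t; rewrite /klevel; case: ifP.
Qed.

HB.instance Definition _ := isKernel.Build _ _ _ _ _ klevel measurable_klevel.

Let klevel_uub : measure_fam_uub klevel.
Proof.
exists j.+1%:R => t; rewrite /klevel; case: ifPn => [/andP[_ h]|_].
  by rewrite /= /mrestr setTI.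
by rewrite /= /mzero lte_fin.
Qed.

HB.instance Definition _ := Kernel_isFinite.Build _ _ _ _ R klevel klevel_uub.

End level.

(** Only the level given by the integer part of [k t D] contributes to the series. *)
Lemma kseries_klevel (D : set Y) (mD : measurable D) t U :
  k t D < +oo -> kseries (klevel mD) t U = k t (U `&` D).
Proof.
move=> kD; have kD0 : 0 <= k t D by [].
have [r r0 kDE] : exists2 r, (0 <= r)%R & k t D = r%:E.
  by exists (fine (k t D)); rewrite ?fine_ge0// fineK// ge0_fin_numE.
rewrite /kseries/= /mseries (nneseriesD1 (n := Num.truncn r))//.
rewrite eseries0 ?adde0.
  have -> // : klevel mD (Num.truncn r) t = mrestr (k t) mD.
  by rewrite /klevel ifT// kDE !lee_fin !lte_fin truncn_itv.
move=> j _ /andP[_ jn].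
rewrite /klevel ifF//; apply: contraNF jn; rewrite kDE lee_fin lte_fin => jr.
by apply/eqP/esym/truncn_def.
Qed.

(* [K t] sums the restrictions of [k t] to those pieces of [Y] which have finite
   mass, each of them cut according to the integer part of that mass. *)
Lemma sfinite_cutoff (E : (set Y)^nat) : (forall n, measurable (E n)) ->
  \bigcup_n E n = setT -> exists K : R.-sfker T ~> Y,
  forall t, (forall n, k t (E n) < +oo) ->
  forall U, measurable U -> K t U = k t U.
Proof.
move=> mE ET; have mD := seqDU_measurable mE.
exists (kseries (fun n => kseries (klevel (mD n)))) => t kE U mU.
transitivity (\sum_(n <oo) kseries (klevel (mD n)) t U) => //.
transitivity (\sum_(n <oo) k t (U `&` seqDU E n)).
  apply: eq_eseriesr => n _; apply: kseries_klevel.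
  apply: le_lt_trans (kE n); apply: le_measure; rewrite ?inE//.
  exact: subset_seqDU.
rewrite -measure_semi_bigcup//.
- by rewrite -setI_bigcupr -seqDU_bigcup_eq ET setIT.
- by move=> n; exact: measurableI.
- exact/trivIset_setIl/trivIset_seqDU.
- by apply: bigcup_measurable => n _; exact: measurableI.
Qed.

End sfinite_cutoff.

(** * Counting measures, and measurability of operations on configurations *)

Section counting.
Variable R : realType.
Local Notation counting := (@counting _ R).

Lemma counting_card_eq (T U : choiceType) (A : set T) (B : set U) :
  (A #= B)%card -> counting A = counting B.
Proof.
move=> AB; rewrite !/counting.
have [[n An]|nA] := pselect (finite_set A).
  have Bn : (B #= `I_n)%card by rewrite -(card_eql AB).
  have fA : finite_set A by exists n.
  have fB : finite_set B by exists n.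
  by rewrite (asboolT fA) (asboolT fB)
    (card_fset_set An) (card_fset_set Bn).
by rewrite !asboolF//= -(eq_finite_set AB).
Qed.

Lemma counting_fin (T : choiceType) (A : set T) :
  finite_set A -> counting A < +oo.
Proof. by move=> fA; rewrite /counting asboolT// ltry. Qed.

Lemma counting_eq0 (T : choiceType) (A : set T) : counting A = 0 <-> A = set0.
Proof.
split=> [|->]; last by rewrite /counting asboolT// fset_set0.
rewrite /counting; case: ifPn => //= /asboolP fA [] /eqP.
rewrite pnatr_eq0 finmap.cardfs_eq0 => /eqP A0.
by rewrite -(fset_setK fA) A0 set_fset0.
Qed.

Lemma counting_set1 (T : choiceType) (x : T) : counting [set x] = 1.
Proof. by rewrite /counting asboolT// fset_set1 finmap.cardfs1. Qed.

End counting.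

Section counting_kernel.
Context d d1 (T : measurableType d) (Y : measurableType d1) (R : realType).
Variables (V : T -> set Y) (E : (set Y)^nat).
Hypothesis mset1 : forall y : Y, measurable [set y].
Hypothesis mE : forall n, measurable (E n).
Hypothesis ET : \bigcup_n E n = setT.
Hypothesis finV : forall t n, finite_set (V t `&` E n).
Hypothesis mcount : forall U, measurable U ->
  measurable_fun setT (fun t => @counting Y R (U `&` V t)).

Let mV t : measurable (V t).
Proof.
rewrite -[V t]setIT -ET setI_bigcupr; apply: bigcupT_measurable => n.
rewrite -[X in measurable X]image_id -bigcup_imset1.
by apply: fin_bigcup_measurable => // x _; exact: mset1.
Qed.

Let kcount (t : T) : {measure set Y -> \bar R} := mrestr counting (mV t).

HB.instance Definition _ := isKernel.Build _ _ T Y R kcount mcount.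

(** Every [V t] is finite on each [E n], so the cutoff changes nothing at any [t]. This serves for
    points and, later, for ordered edges. *)
Lemma counting_kernel : exists K : R.-sfker T ~> Y,
  forall t U, measurable U -> K t U = counting (U `&` V t).
Proof.
have [K KE] := sfinite_cutoff kcount mE ET; exists K => t U mU.
rewrite KE// => n; rewrite [ltLHS]/= /mrestr setIC.
exact: counting_fin.
Qed.

End counting_kernel.

Section measurable_config.
Context d (R : realType) (X : localised_borel d R).

Lemma measurable_config_measure (B : set X) : measurable B ->
  measurable_fun setT (fun xi : config X => config_measure xi B).
Proof.
move=> mB.
apply: (@measurability config_display _ (config X) _ setT
  (fun xi => config_measure xi B) measurable).
  by rewrite smallest_id//; exact: sigma_algebra_measurable.
apply: subset_trans; last exact: sub_gen_smallest.
exact: (bigcup_sup mB).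
Qed.

Lemma measurable_fun_config d' (T : measurableType d') (F : T -> config X) :
  (forall B, measurable B ->
    measurable_fun setT (fun t => config_measure (F t) B)) ->
  measurable_fun setT F.
Proof.
move=> mF.
pose G : set_system (config X) := \bigcup_(B in @measurable d X)
  preimage_set_system setT (fun xi : config X => config_measure xi B) measurable.
apply: (measurability G) => //= _ [_ [B mB [Y mY <-]] <-].
have := mF _ mB measurableT _ mY.
by rewrite !setTI.
Qed.

Lemma config_kernel : exists K : R.-sfker config X ~> X,
  forall xi U, measurable U -> K xi U = config_measure xi U.
Proof.
have [S [bS _ ST _]] := bounded_exhaust X.
apply: (counting_kernel (E := S)) => //.
- exact: lb_measurable_set1.
- by move=> n; exact: bounded_measurable.
- by move=> xi n; exact: config_locally_finite.
- exact: measurable_config_measure.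
Qed.

Lemma configP (xi eta : config X) : (xi : set X) = eta -> xi = eta.
Proof.
case: xi eta => [A fA] [B fB] /= AB; rewrite AB in fA *.
by congr Config; exact: Prop_irrelevance.
Qed.

(** The sigma-algebra on configurations only controls counts of fixed sets; viewing the counts as an
    s-finite kernel allows the set to vary with [t]. *)
Lemma measurable_config_section d' (T : measurableType d') (F : T -> config X)
    (A : set (T * X)) : measurable_fun setT F -> measurable A ->
  measurable_fun setT (fun t => config_measure (F t) [set x | A (t, x)]).
Proof.
move=> mF mA; have [K KE] := config_kernel.
rewrite (_ : (fun t => _) = fun t => K (F t) [set x | A (t, x)]).
  exact: measurable_kernel_xsection.
apply/funext => t; rewrite KE//.
by have := measurable_xsection t mA; rewrite xsectionE.
Qed.

Lemma lb_measurable_diag : measurable [set p : X * X | p.1 = p.2].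
Proof.
rewrite -[X in measurable X]setCK; apply: measurableC.
exact: lb_measurable_offdiag.
Qed.

Lemma lb_measurable_fun_eq d' (T : measurableType d') (f g : T -> X) :
  measurable_fun setT f -> measurable_fun setT g ->
  measurable [set t | f t = g t].
Proof.
move=> mf mg; have := measurable_fun_pair mf mg measurableT lb_measurable_diag.
by rewrite setTI.
Qed.

Lemma measurable_mem_config d' (T : measurableType d') (F : T -> config X)
    (f : T -> X) : measurable_fun setT F -> measurable_fun setT f ->
  measurable [set t | (F t : set X) (f t)].
Proof.
move=> mF mf.
have mA : measurable [set z : T * X | z.2 = f z.1].
  by apply: lb_measurable_fun_eq => //; exact: measurableT_comp.
(* [f t] is a point of [F t] exactly when [F t] has nonzero mass on the section of the graph of
   [f]. *)
have := measurable_config_section mF mA measurableT (emeasurable_set1 0).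
rewrite setTI => /measurableC; congr measurable; apply/seteqP; split=> t /=.
  move=> n0; apply: contrapT => Ft; apply: n0; apply/counting_eq0.
  by apply/seteqP; split=> x //= [->].
by move=> Ft /counting_eq0 /seteqP[/(_ (f t))+ _]; apply; split.
Qed.

Lemma measurable_del_point d' (T : measurableType d') (F : T -> config X)
    (f : T -> X) : measurable_fun setT F -> measurable_fun setT f ->
  measurable_fun setT (fun t => del_point (F t) (f t)).
Proof.
move=> mF mf; apply: measurable_fun_config => B mB.
have mA : measurable [set z : T * X | B z.2 /\ z.2 <> f z.1].
  apply: measurableI.
    by rewrite -[X in measurable X]setTI; exact: measurable_snd.
  apply: measurableC; apply: lb_measurable_fun_eq => //.
  exact: measurableT_comp.
rewrite (_ : (fun t => _) =
    fun t => config_measure (F t) [set x | B x /\ x <> f t]).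
  exact: (measurable_config_section mF mA).
apply/funext => t; congr counting.
by apply/seteqP; split=> x /=; tauto.
Qed.

Lemma measurable_add_point d' (T : measurableType d') (F : T -> config X)
    (f : T -> X) : measurable_fun setT F -> measurable_fun setT f ->
  measurable_fun setT (fun t => add_point (F t) (f t)).
Proof.
move=> mF mf; apply: measurable_fun_config => B mB.
(* [N] is where the added point is new and lies in [B], hence where the count grows by one. *)
pose N : set T := [set t | B (f t)] `\` [set t | (F t : set X) (f t)].
have mN : measurable N.
  apply: measurableD; last exact: measurable_mem_config.
  by rewrite -[X in measurable X]setTI; exact: mf.
rewrite (_ : (fun t => _) = fun t => config_measure (F t) B + (\1_N t)%:E).
  apply: emeasurable_funD; last exact/measurable_EFinP.
  exact: (measurableT_comp (measurable_config_measure mB) mF).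
apply/funext => t; rewrite /config_measure/= /mrestr indicE.
have [Nt|nNt] := pselect (N t).
  rewrite mem_set//= -(counting_set1 R (f t)) -measureU.
  - congr counting; apply/seteqP; split=> x /=; first tauto.
    by move=> [[Bx Fx]|->]; [split; [|right]|split; [case: Nt|left]].
  - exact/measurableI/config_measurable.
  - exact: lb_measurable_set1.
  - by apply/seteqP; split=> x //= -[[_ Fx] xf]; case: Nt => _ /=; rewrite -xf.
rewrite memNset//= adde0; congr counting; apply/seteqP; split=> x /=; last tauto.
move=> [Bx [xf|//]]; split => //; apply: contrapT => Fx; apply: nNt.
by rewrite xf in Bx Fx.
Qed.

End measurable_config.

(** * Measurability of operations on edge configurations *)

Section measurable_econfig.
Context d (R : realType) (X : localised_borel d R).

Lemma measurable_fun_econfig d' (T : measurableType d') (F : T -> econfig X) :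
  (forall C, edge_measurable C ->
    measurable_fun setT (fun t => edge_count (F t) C)) ->
  measurable_fun setT F.
Proof.
move=> mF.
pose G : set_system (econfig X) := \bigcup_(C in @edge_measurable d R X)
  preimage_set_system setT (fun s : econfig X => edge_count s C) measurable.
apply: (measurability G) => //= _ [_ [C mC [Y mY <-]] <-].
have := mF _ mC measurableT _ mY.
by rewrite !setTI.
Qed.

(* Pulling the order of [R] back along a Borel injection orders the two ends of
   each edge, so that an edge configuration becomes a locally finite subset of
   [X * X]. *)
Section ordered_edges.
Variables (phi : X -> R) (mphi : measurable_fun setT phi) (iphi : injective phi).

Let lt (p : X * X) : Prop := (phi p.1 < phi p.2)%R.

Let ordered (s : econfig X) : set (X * X) :=
  [set p | lt p /\ edges s [set p.1; p.2]].

Let lt_inj p q : lt p -> lt q -> [set p.1; p.2] = [set q.1; q.2] -> p = q.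
Proof.
case: p q => [a b] [y z] ab yz /= /pair_set2[]; move: ab yz; rewrite /lt/=.
move=> + + [ay|az] [by_|bz]; rewrite ?ay ?az ?by_ ?bz ?ltxx// => h1 h2.
by have := lt_trans h1 h2; rewrite ltxx.
Qed.

(** Since [phi] is injective, the two ends of an edge have distinct images, and exactly one of the
    two orderings is increasing. *)
Let edge_count_ordered (s : econfig X) (C : set (set X)) :
  edge_count s C = counting (ordered s `&` [set p | C [set p.1; p.2]]).
Proof.
apply: counting_card_eq.
rewrite (_ : _ `&` C = (fun p : X * X => [set p.1; p.2]) @`
    (ordered s `&` [set p | C [set p.1; p.2]])).
  apply: inj_card_eq => p q /set_mem[[pl _] _] /set_mem[[ql _] _].
  exact: lt_inj.
apply/seteqP; split => [e [se Ce]|_ [p [[_ sp] Cp]] <-]; last by split.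
have [y [z [_ _ yz e_]]] := edges_pairs se.
have : (phi y != phi z)%R by apply/eqP => /iphi.
rewrite neq_lt => /orP[h|h]; [exists (y, z)|exists (z, y)] => //=;
  rewrite /ordered/= e_ in se Ce *.
- by [].
- by rewrite setUC; split => //; split.
- by rewrite setUC.
Qed.

Let measurable_lt : measurable [set p | lt p].
Proof.
have m1 : measurable_fun setT (fun p : X * X => phi p.1).
  by apply: (measurableT_comp mphi); exact: measurable_fst.
have m2 : measurable_fun setT (fun p : X * X => phi p.2).
  by apply: (measurableT_comp mphi); exact: measurable_snd.
have := measurable_fun_ltr m1 m2.
by move=> /(_ measurableT [set true] I); rewrite setTI.
Qed.

Let measurable_ordered_count U : measurable U ->
  measurable_fun setT (fun s => @counting _ R (U `&` ordered s)).
Proof.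
move=> mU.
(* Edges whose increasing ordering lies in [U]. The corresponding set of ordered pairs is the union
   of the increasing part of [U] and its mirror image. *)
pose C : set (set X) := [set [set p.1; p.2] | p in U `&` [set p | lt p]].
have mUl : measurable (U `&` [set p | lt p]) by exact: measurableI.
have mC : edge_measurable C.
  split.
    move=> _ [[y z] [_ yz] <-]; exists y, z; split => //= e.
    by move: yz; rewrite /lt/= e ltxx.
  rewrite (_ : [set _ | _] = (U `&` [set p | lt p]) `|`
      ((fun p : X * X => (p.2, p.1)) @^-1` (U `&` [set p | lt p]))).
    apply: measurableU => //.
    rewrite -[X in measurable X]setTI.
    by apply: (measurable_fun_pair (f := snd) (g := fst)).
  apply/seteqP; split => -[a b] /=.
    move=> [ab [q [Uq ltq] E]].
    have : (phi a != phi b)%R by apply/eqP => /iphi.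
    rewrite neq_lt => /orP[h|h].
      by left; have <- : q = (a, b) by exact: lt_inj.
    right; have <- // : q = (b, a).
    by apply: lt_inj => //=; rewrite E setUC.
  move=> [[Uab ltab]|[Uab ltab]].
  - split; first by move=> e; move: ltab; rewrite /lt/= e ltxx.
    by exists (a, b).
  - split; first by move=> e; move: ltab; rewrite /lt/= e ltxx.
    by exists (b, a) => //=; rewrite setUC.
rewrite (_ : (fun s => _) = fun s : econfig X => edge_count s C);
  first exact: measurable_edge_count.
apply/funext => s; rewrite edge_count_ordered; congr counting.
apply/seteqP; split => [p /= [Up sp]|p /= [[ltp sp] [q [Uq ltq] /lt_inj qp]]].
  by split => //; exists p => //; split => //; case: sp.
by split; [rewrite -(qp ltq ltp)|split].
Qed.

Let ordered_kernel : exists K : R.-sfker econfig X ~> (X * X)%type,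
  forall s U, measurable U -> K s U = counting (U `&` ordered s).
Proof.
have [S [bS ndS ST _]] := bounded_exhaust X.
apply: (counting_kernel (E := fun n => S n `*` S n)) => //.
- move=> [a b]; rewrite (_ : [set _] = [set a] `*` [set b]).
    by apply: measurableX; exact: lb_measurable_set1.
  by apply/seteqP; split => -[y z] /= [-> ->].
- by move=> n; apply: measurableX; exact: bounded_measurable.
- apply/seteqP; split => // -[a b] _.
  have [n _ Sa] : (\bigcup_n S n) a by rewrite ST.
  have [m _ Sb] : (\bigcup_n S n) b by rewrite ST.
  exists (maxn n m) => //; split => /=.
    by have /subsetPset := ndS _ _ (leq_maxl n m); exact.
  by have /subsetPset := ndS _ _ (leq_maxr n m); exact.
- move=> s n.
  (* Forgetting the order is injective on increasing pairs, so finiteness passes from edges inside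
     [S n] to ordered pairs. *)
  have /eq_finite_set <- : (((fun p : X * X => [set p.1; p.2]) @`
      (ordered s `&` (S n `*` S n))) #= ordered s `&` (S n `*` S n))%card.
    apply: inj_card_eq => p q /set_mem[[pl _] _] /set_mem[[ql _] _].
    exact: lt_inj.
  apply: sub_finite_set (econfig_locally_finite s (bS n)).
  move=> _ [[a b] [[ltab sab] [Sa Sb]] <-]; split => //=.
  by exists a, b; split => // e; move: ltab; rewrite /lt/= e ltxx.
Qed.

(** As for points, the kernel of ordered edges allows the set of edges to depend on [t], provided
    that it is jointly measurable as a set of ordered pairs. *)
Lemma measurable_edge_count_section d' (T : measurableType d')
    (F : T -> econfig X) (C : T -> set (set X)) : measurable_fun setT F ->
  measurable [set z : T * (X * X) | z.2.1 <> z.2.2 /\ C z.1 [set z.2.1; z.2.2]] ->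
  measurable_fun setT (fun t => edge_count (F t) (C t)).
Proof.
move=> mF mC; have [K KE] := ordered_kernel.
have := measurable_kernel_xsection K mF mC.
rewrite [X in measurable_fun _ X -> _](_ : _ =
  fun t => edge_count (F t) (C t))//.
apply/funext => t; rewrite KE.
  rewrite edge_count_ordered; congr counting.
  apply/seteqP; split => p /= [].
    by move=> [_ Cp] sp; split.
  move=> [ltp sp] Cp; split; split => // e.
  by move: ltp; rewrite /lt e ltxx.
by have := measurable_xsection t mC; rewrite xsectionE.
Qed.

End ordered_edges.

Lemma measurable_fun_econfig_restr d' (T : measurableType d')
    (F : T -> econfig X) (C : T -> set (set X)) : measurable_fun setT F ->
  measurable [set z : T * (X * X) | z.2.1 <> z.2.2 /\ C z.1 [set z.2.1; z.2.2]] ->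
  measurable_fun setT (fun t => econfig_restr (F t) (C t)).
Proof.
move=> mF mC; have [phi [mphi iphi _]] := lb_borel X.
apply: measurable_fun_econfig => D [_ mD].
rewrite (_ : (fun t => _) = fun t => edge_count (F t) (C t `&` D)).
  apply: (measurable_edge_count_section mphi iphi mF).
  have mD' : measurable (@snd T (X * X) @^-1`
      [set p : X * X | p.1 <> p.2 /\ D [set p.1; p.2]]).
    by rewrite -[X in measurable X]setTI; exact: measurable_snd.
  have := measurableI _ _ mC mD'; congr measurable.
  by apply/seteqP; split => z /=; tauto.
by apply/funext => t; rewrite /edge_count setIA.
Qed.

Section pairs_and_stars.
Context d' (T : measurableType d') (F : T -> econfig X) (V : T -> set X).
Hypothesis mF : measurable_fun setT F.
Hypothesis mV : measurable [set z : T * X | V z.1 z.2].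

Let mV1 : measurable [set z : T * (X * X) | V z.1 z.2.1].
Proof.
rewrite -[X in measurable X]setTI.
apply: (measurable_fun_pair (f := fst) (g := fst \o snd) _ _ measurableT mV) => //.
exact: measurableT_comp.
Qed.

Let mV2 : measurable [set z : T * (X * X) | V z.1 z.2.2].
Proof.
rewrite -[X in measurable X]setTI.
apply: (measurable_fun_pair (f := fst) (g := snd \o snd) _ _ measurableT mV) => //.
exact: measurableT_comp.
Qed.

Let mne : measurable [set z : T * (X * X) | z.2.1 <> z.2.2].
Proof.
apply: measurableC; apply: lb_measurable_fun_eq; exact: measurableT_comp.
Qed.

Lemma measurable_econfig_restr_pairs :
  measurable_fun setT (fun t => econfig_restr (F t) (pairs (V t))).
Proof.
apply: measurable_fun_econfig_restr => //.
have := measurableI _ _ mne (measurableI _ _ mV1 mV2); congr measurable.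
apply/seteqP; split => -[t [a b]] /=.
  by move=> [ab [Va Vb]]; split => //; exists a, b.
move=> [ab [y [z [Vy Vz yz /pair_set2[ayz byz]]]]]; split => //; split.
  by case: ayz => ->.
by case: byz => ->.
Qed.

Lemma measurable_econfig_restr_star (f : T -> X) : measurable_fun setT f ->
  measurable_fun setT (fun t => econfig_restr (F t) (star (V t) (f t))).
Proof.
move=> mf; apply: measurable_fun_econfig_restr => //.
have m1 : measurable [set z : T * (X * X) | z.2.1 = f z.1].
  by apply: lb_measurable_fun_eq; exact: measurableT_comp.
have m2 : measurable [set z : T * (X * X) | z.2.2 = f z.1].
  by apply: lb_measurable_fun_eq; exact: measurableT_comp.
have := measurableI _ _ mne
  (measurableU _ _ (measurableI _ _ m1 mV2) (measurableI _ _ m2 mV1)).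
congr measurable; apply/seteqP; split => -[t [a b]] /=.
  move=> [ab [[<- Vb]|[<- Va]]]; split => //; [exists b|exists a] => //.
  by rewrite setUC.
move=> [ab [y Vy E]]; split => //.
have [[ay|af] [by_|bf]] := pair_set2 (esym E).
- by exfalso; apply: ab; rewrite ay by_.
- by right; rewrite ay.
- by left; rewrite by_.
- by exfalso; apply: ab; rewrite af bf.
Qed.

End pairs_and_stars.

Lemma measurable_fun_split_at d' (T : measurableType d') (F : T -> econfig X)
    (f : T -> X) : measurable_fun setT F -> measurable_fun setT f ->
  measurable_fun setT (fun t => split_at (f t) (F t)).
Proof.
move=> mF mf.
have mV : measurable [set z : T * X | (~` [set f z.1]) z.2].
  by apply: measurableC; apply: lb_measurable_fun_eq => //; exact: measurableT_comp.
apply: measurable_fun_pair.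
  exact: measurable_econfig_restr_pairs.
exact: measurable_econfig_restr_star.
Qed.

End measurable_econfig.

(** * Fubini for kernels, and transfer of almost sure statements *)

Lemma kernel_Fubini d1 d2 d3 d4 (T : measurableType d1) (U : measurableType d2)
    (Y : measurableType d3) (Z : measurableType d4) (R : realType)
    (k : R.-sfker T ~> Y) (l : R.-sfker U ~> Z) t u (F : Y * Z -> \bar R) :
  (forall z, 0 <= F z) -> measurable_fun setT F ->
  \int[k t]_y \int[l u]_z F (y, z) = \int[l u]_z \int[k t]_y F (y, z).
Proof.
move=> F0 mF.
(* The values of an s-finite kernel are s-finite measures; this structure is packed explicitly so
   that [sfinite_Fubini] applies. *)
pose Hk := isSFinite.Build _ _ _ _ (sfinite_kernel_measure k t).
pose kt := HB.pack_for (SFiniteMeasure.type Y R) (Measure.sort (k t)) Hk.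
pose Hl := isSFinite.Build _ _ _ _ (sfinite_kernel_measure l u).
pose lu := HB.pack_for (SFiniteMeasure.type Z R) (Measure.sort (l u)) Hl.
have ktE : k t = kt by exact: eq_measure.
have luE : l u = lu by exact: eq_measure.
by rewrite ktE luE; exact: sfinite_Fubini.
Qed.

Lemma config_ae d (R : realType) (X : localised_borel d R) (xi : config X) :
  {ae @config_measure d R X xi, forall x, (xi : set X) x}.
Proof.
exists (~` xi); split => //; first exact/measurableC/config_measurable.
by rewrite /config_measure/= /mrestr setICl; apply/counting_eq0.
Qed.

Lemma ae_distribution d d' (W : measurableType d) (T : measurableType d')
    (R : realType) (Pr : probability W R) (Y : {RV Pr >-> T}) (p : T -> Prop) :
  {ae distribution Pr Y, forall t, p t} -> {ae Pr, forall w, p (Y w)}.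
Proof.
move=> [N [mN N0 pN]]; exists (Y @^-1` N); split => //.
- by rewrite -[X in measurable X]setTI; exact: measurable_funPT.
- by move=> w /= pw; exact: pN.
Qed.

(** * The Papangelou kernel: local finiteness and an s-finite version *)

Section papangelou.
Context d dW (R : realType) (X : localised_borel d R) (W : measurableType dW)
  (Pr : probability W R) (Xi : {RV Pr >-> config X}) (L : R.-ker config X ~> X).
Hypothesis papL : is_papangelou Xi L.
Let P := distribution Pr Xi.

(* With [g] the indicator of [xi B <= n] and [x \in B], the defining identity of
   [L] bounds the expectation of [L (Xi) B] over [Xi B <= n] by [n + 1]. *)
Lemma papangelou_locally_finite (B : set X) : bounded B ->
  {ae P, forall xi, L xi B < +oo}.
Proof.
move=> bB; have mB := bounded_measurable bB.
pose E (n : nat) : set (config X) :=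
  [set xi | config_measure xi B <= n%:R%:E].
have mE n : measurable (E n).
  rewrite -[X in measurable X]setTI.
  exact: (emeasurable_fun_infty_c measurableT (measurable_config_measure mB)).
have mL : measurable_fun setT (fun xi => L xi B) by exact: measurable_kernel.
have mEL n : measurable_fun setT (fun xi => (\1_(E n) xi)%:E * L xi B).
  by apply: emeasurable_funM => //; exact/measurable_EFinP.
have EL0 n xi : 0 <= (\1_(E n) xi)%:E * L xi B.
  by apply: mule_ge0 => //; rewrite lee_fin.
have EL n : \int[P]_xi ((\1_(E n) xi)%:E * L xi B) <= n.+1%:R%:E.
  have mEB : measurable (E n `*` B) by exact: measurableX.
  have g0 u : (0 <= \1_(E n `*` B) u :> R)%R by [].
  have := papL (measurable_indic mEB) g0.
  rewrite ge0_integral_distribution//.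
  rewrite (_ : \int[Pr]_w \int[L (Xi w)]_x (\1_(E n `*` B) (Xi w, x))%:E =
      \int[Pr]_w ((fun xi => (\1_(E n) xi)%:E * L xi B) \o Xi) w); last first.
    apply: eq_integral => w _ /=.
    under eq_integral => x _.
      rewrite indicE in_setX/= -mulnb natrM EFinM -!indicE; over.
    rewrite ge0_integralZl ?integral_indic ?setIT//.
    exact/measurable_EFinP.
  move=> <-.
  rewrite (_ : n.+1%:R%:E = \int[Pr]_w cst n.+1%:R%:E w); last first.
    rewrite [RHS](_ : _ = n.+1%:R%:E * Pr setT); last exact: integral_cst.
    by rewrite probability_setT mule1.
  apply: ge0_ae_le_integral => //.
  - by move=> w; apply: integral_ge0 => x _; rewrite lee_fin.
  - by move=> w; rewrite lee_fin.
  apply: aeW => w /=; set xi := Xi w.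
  (* Deleting a point of [B] lowers the count by one. Above [n + 1], every such deletion leaves more
     than [n] points in [B] and the integrand vanishes on [xi]; otherwise the integral is at most
     the count of [B]. *)
  have [xiB|xiB] := leP (config_measure xi B) n.+1%:R%:E.
    apply: (@le_trans _ _ (\int[config_measure xi]_x (\1_B x)%:E)).
      apply: ge0_ae_le_integral => [x|x|]; rewrite ?lee_fin//.
      apply: aeW => x; rewrite lee_fin !indicE.
      have [xB|xB] := boolP (x \in B); first by case: (_ \in _).
      by rewrite memNset// => -[_ /mem_set]; exact/negP.
    by rewrite integral_indic// setIT.
  rewrite [leLHS](_ : _ = \int[config_measure xi]_x cst 0 x); last first.
    apply: ae_integral_eq; apply: filterS (config_ae xi) => x xix.
    rewrite indicE memNset// => -[/= + Bx].
    rewrite /E/= leNgt => /negP; apply.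
    have : config_measure xi B = config_measure (del_point xi x) B + 1.
      rewrite /config_measure/= /mrestr -(counting_set1 R x) -measureU//.
      - congr counting; apply/seteqP; split => y /=.
          move=> [By xiy]; have [->|yx] := pselect (y = x); first by right.
          by left.
        by move=> [[By [xiy _]]|->].
      - exact: (measurableI _ _ mB (config_measurable (del_point xi x))).
      - exact: lb_measurable_set1.
      - by apply/seteqP; split => y //= [[_ [_ yx]]].
    move=> E1; move: xiB; rewrite E1 -natr1 EFinD.
    by rewrite lteD2rE.
  by rewrite integral0 lee_fin.
have ae n : {ae P, forall xi, (\1_(E n) xi)%:E * L xi B < +oo}.
  have : P.-integrable setT (fun xi => (\1_(E n) xi)%:E * L xi B).
    apply/integrableP; split => //; under eq_integral do rewrite gee0_abs//.
    by apply: le_lt_trans (EL n) _; rewrite ltry.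
  move=> /(integrable_ae measurableT); apply: filterS => xi /(_ I).
  by rewrite ge0_fin_numE.
have /ae_foralln := ae; apply: filterS => xi H.
have xiB : config_measure xi B < +oo.
  by apply: counting_fin; rewrite setIC; exact: config_locally_finite.
have [n xin] : exists n, E n xi.
  exists (Num.truncn (fine (config_measure xi B))).+1.
  rewrite /E/= -[leLHS]fineK ?ge0_fin_numE// lee_fin ltW//.
  exact: truncnS_gt.
by have := H n; rewrite indicE mem_set// mul1e.
Qed.

(** [K] is the cutoff of [L] along an exhaustion by bounded sets, on each of which [L] is almost
    surely finite. The defining identity of [L] is used for indicators only, and [eq_mixture]
    extends it to functions that may take the value +oo, as conditional means of [h] can. *)
Lemma papangelou_version : exists K : R.-sfker config X ~> X,
  {ae P, forall xi, forall U, measurable U -> L xi U = K xi U} /\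
  forall F : config X * X -> \bar R, (forall z, 0 <= F z) ->
    measurable_fun setT F ->
    \int[P]_xi \int[config_measure xi]_x F (del_point xi x, x) =
    \int[P]_xi \int[K xi]_x F (xi, x).
Proof.
have [S [bS _ ST _]] := bounded_exhaust X.
have [K KL] := sfinite_cutoff L (fun n => bounded_measurable (bS n)) ST.
have KLae : {ae P, forall xi, forall U, measurable U -> L xi U = K xi U}.
  have /ae_foralln := fun n => papangelou_locally_finite (bS n).
  by apply: filterS => xi Lxi U mU; rewrite KL.
exists K; split => // F F0 mF.
have [C CE] := config_kernel X.
have CEi xi (g : X -> \bar R) :
    \int[config_measure xi]_x g x = \int[C xi]_x g x.
  by apply: eq_measure_integral => A mA _; rewrite CE.
under eq_integral do rewrite CEi.
have mdel : measurable_fun setT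
    (fun z : config X * X => (del_point z.1 z.2, z.2)).
  by apply: measurable_fun_pair => //; exact: measurable_del_point.
apply: (eq_mixture (psi' := id) mdel) => // A mA.
have mg (psi : config X * X -> config X * X) (k : R.-sfker config X ~> X) :
    measurable_fun setT psi ->
    measurable_fun setT (fun xi => \int[k xi]_x (\1_A (psi (xi, x)))%:E).
  move=> mpsi; apply: (measurable_fun_integral_sfinite_kernel
    (fun z => (\1_A (psi z))%:E) k).
    by move=> z; rewrite lee_fin.
  by apply/measurable_EFinP; exact: measurableT_comp.
rewrite !ge0_integral_distribution//; last 4 first.
- exact: (mg id).
- by move=> xi; apply: integral_ge0 => x _; rewrite lee_fin.
- exact: mg mdel.
- by move=> xi; apply: integral_ge0 => x _; rewrite lee_fin.
have A0 u : (0 <= \1_A u :> R)%R by [].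
have := papL (measurable_indic mA) A0.
under eq_integral do rewrite CEi.
move=> -> ; apply: ae_integral_eq.
have := ae_distribution KLae; apply: filterS => w KLw.
by apply: eq_measure_integral => U mU _; exact: KLw.
Qed.

End papangelou.

(** * Splitting the edges at a point *)

Section edge_kernel.
Context d (R : realType) (X : localised_borel d R).
Variables (Q : R.-pker config X ~> econfig X)
  (Q21 : R.-pker (config X * X * econfig X) ~> econfig X).
Hypothesis edgeQ : is_edge_kernel Q.
Hypothesis disQ : is_split_disintegration Q Q21.
Variable h : config X * econfig X * X * econfig X -> R.
Hypothesis mh : measurable_fun setT h.
Hypothesis h0 : forall u, (0 <= h u)%R.

Lemma add_del_point (xi : config X) x : (xi : set X) x ->
  add_point (del_point xi x) x = xi.
Proof.
move=> xix; apply: configP; apply/seteqP; split => y /=.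
  by move=> [->|[]].
by move=> xiy; have [->|yx] := pselect (y = x); [left|right].
Qed.

Lemma econfigP (s t : econfig X) : edges s = edges t -> s = t.
Proof.
case: s t => [A A2 fA] [B B2 fB] /= AB; rewrite AB in A2 fA *.
by congr EConfig; exact: Prop_irrelevance.
Qed.

(** The two restrictions could differ only by edges with an end outside [xi], and [s] has none. *)
Lemma restr_pairs_del_point (xi : config X) (s : econfig X) x :
  edges s `<=` pairs xi ->
  econfig_restr s (pairs (del_point xi x)) = (split_at x s).1.
Proof.
move=> sxi; apply: econfigP; apply/seteqP; split => e /= [se].
  by move=> [y [z [[_ yx] [_ zx] yz e_]]]; split => //; exists y, z.
move=> [y [z [yx zx yz e_]]]; split => //; exists y, z.
have [a [b [xia xib _]]] := sxi _ se; rewrite e_ => /pair_set2[yab zab].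
by split => //; split => //; [case: yab|case: zab] => ->.
Qed.

Lemma restr_star_del_point (xi : config X) (s : econfig X) x :
  edges s `<=` pairs xi ->
  econfig_restr s (star (del_point xi x) x) = (split_at x s).2.
Proof.
move=> sxi; apply: econfigP; apply/seteqP; split => e /= [se].
  by move=> [y [_ yx] e_]; split => //; exists y.
move=> [y yx e_]; split => //; exists y => //; split => //.
have [a [b [xia xib _]]] := sxi _ se.
by rewrite -e_ => /pair_set2[[->|->] _].
Qed.

(** The function [f] of the theorem, uncurried so that its joint measurability can be stated. *)
Definition split_mean (z : config X * X * econfig X) : \bar R :=
  \int[Q21 z]_s2 (h (z.1.1, z.2, z.1.2, s2))%:E.

Lemma split_mean_ge0 z : 0 <= split_mean z.
Proof. by apply: integral_ge0 => s _; rewrite lee_fin. Qed.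

Lemma measurable_split_mean : measurable_fun setT split_mean.
Proof.
apply: (measurable_fun_integral_sfinite_kernel
  (fun z : (config X * X * econfig X) * econfig X =>
    (h (z.1.1.1, z.1.2, z.1.1.2, z.2))%:E) Q21).
  by move=> z; rewrite lee_fin.
apply/measurable_EFinP; apply: (measurableT_comp mh).
apply: measurable_fun_pair => //; apply: measurable_fun_pair.
  apply: measurable_fun_pair.
    apply: measurableT_comp => //; apply: measurableT_comp => //.
  exact: measurableT_comp.
apply: measurableT_comp => //; exact: measurableT_comp.
Qed.

Lemma integral_split_law1 (f : econfig X -> \bar R) xi x :
  measurable_fun setT f -> (forall s, 0 <= f s) ->
  \int[split_law1 Q xi x]_s f s =
  \int[Q (add_point xi x)]_s f (split_at x s).1.
Proof.
move=> mf f0.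
rewrite /split_law1 /distribution ge0_integral_pushforward//= preimage_setT.
rewrite /split_law /distribution ge0_integral_pushforward//=.
exact: measurableT_comp.
Qed.

(** The split law is a family of image measures, not declared as a kernel; transporting the integral
    back to [Q] at [add_point] reduces the claim to the kernel [Q] and the joint measurability of
    [split_at]. *)
Lemma measurable_integral_split_law1 :
  measurable_fun setT (fun z : config X * X =>
    \int[split_law1 Q z.1 z.2]_s split_mean (z, s)).
Proof.
under eq_fun => z.
  rewrite integral_split_law1; last 2 first.
  - exact: measurableT_comp measurable_split_mean _.
  - by move=> s; exact: split_mean_ge0.
  over.
apply: (measurable_fun_integral_kprecomp Q
  (g := fun z => split_mean (z.1, (split_at z.1.2 z.2).1))).
- exact: measurable_add_point.
- by move=> z; exact: split_mean_ge0.
- apply: (measurableT_comp measurable_split_mean).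
  apply: measurable_fun_pair => //; apply: measurableT_comp => //.
  by apply: measurable_fun_split_at => //; exact: measurableT_comp.
Qed.

Lemma integral_split_mean (xi : config X) x : ~ (xi : set X) x ->
  \int[split_law1 Q xi x]_s split_mean (xi, x, s) =
  \int[Q (add_point xi x)]_s
    (h (xi, (split_at x s).1, x, (split_at x s).2))%:E.
Proof.
move=> xix.
have mpair : measurable_fun setT (fun s : econfig X => (xi, x, s)).
  exact: pair1_measurable.
pose F (z : econfig X * econfig X) : \bar R := (h (xi, z.1, x, z.2))%:E.
have F0 z : 0 <= F z by rewrite lee_fin.
have mF : measurable_fun setT F.
  apply/measurable_EFinP; apply: (measurableT_comp mh).
  apply: measurable_fun_pair => //; apply: measurable_fun_pair => //.
  exact: measurable_fun_pair.
have := @integral_disintegration _ _ _ _ _ (split_law Q xi x)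
  (split_law1 Q xi x) (kprecomp mpair Q21) F (disQ xix) F0 mF.
by move=> <-; rewrite /split_law /distribution ge0_integral_pushforward.
Qed.

Let H (z : (config X * econfig X) * X) : \bar R :=
  (h (del_point z.1.1 z.2, econfig_restr z.1.2 (pairs (del_point z.1.1 z.2)),
      z.2, econfig_restr z.1.2 (star (del_point z.1.1 z.2) z.2)))%:E.

Lemma measurable_split_integrand : measurable_fun setT H.
Proof.
have mdel : measurable_fun setT
    (fun z : (config X * econfig X) * X => del_point z.1.1 z.2).
  by apply: measurable_del_point => //; exact: measurableT_comp.
have ms : measurable_fun setT
    (fun z : (config X * econfig X) * X => z.1.2) by exact: measurableT_comp.
have mV : measurable [set z : ((config X * econfig X) * X) * X |
    (del_point z.1.1.1 z.1.2 : set X) z.2].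
  apply: (measurable_mem_config (F := fun z => del_point z.1.1.1 z.1.2)) => //.
  exact: (measurableT_comp mdel).
apply/measurable_EFinP; apply: (measurableT_comp mh).
apply: measurable_fun_pair; last exact: measurable_econfig_restr_star.
apply: measurable_fun_pair => //; apply: measurable_fun_pair => //.
exact: measurable_econfig_restr_pairs.
Qed.

(** [x] lies outside [del_point xi x], so the disintegration is available there, and adding [x] back
    gives [xi]. The edge kernel property identifies both restrictions with the components of
    [split_at]. *)
Lemma integral_split_integrand (xi : config X) x : (xi : set X) x ->
  \int[Q xi]_s H ((xi, s), x) =
  \int[split_law1 Q (del_point xi x) x]_s split_mean (del_point xi x, x, s).
Proof.
move=> xix; rewrite integral_split_mean; last by move=> [_]; exact.
rewrite add_del_point//; apply: ae_integral_eq.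
have := edgeQ xi; apply: filterS => s sxi.
by rewrite /H/= restr_pairs_del_point// restr_star_del_point.
Qed.

End edge_kernel.

(** * Assembling the two sides of the identity *)

Lemma ae_semidirect d d' (T : measurableType d) (T' : measurableType d')
    (R : realType) (P : probability T R) (Q : R.-pker T ~> T') (p : T -> Prop) :
  {ae P, forall t, p t} -> {ae semidirect P Q, forall z, p z.1}.
Proof.
move=> [N [mN N0 pN]]; exists (N `*` setT); split.
- exact: measurableX.
- rewrite /= /semidirect -[RHS](integral0 P setT); apply: ae_integral_eq.
  exists N; split => // t /= QN; apply: contrapT => Nt; apply: QN.
  by rewrite notin_xsectionX ?measure0// notin_setE.
- by move=> z /= pz; split => //; exact: pN.
Qed.

(** If [a] and [b] are both infinite, nothing is known of [c], but definedness of [b + c] excludes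
    -oo, so that both sides are +oo. *)
Lemma eq_adde_of_sube (R : realDomainType) (a b c : \bar R) :
  0 <= a -> 0 <= b -> (a < +oo \/ b < +oo -> c = a - b) -> b +? c -> a = b + c.
Proof.
case: a => [a||]//; case: b => [b||]// a0 b0 cE.
- by rewrite cE; [rewrite -EFinB -EFinD addrCA subrr addr0|left; exact: ltry].
- by rewrite cE//; left; exact: ltry.
- by rewrite cE//; right; exact: ltry.
- by case: c cE.
Qed.

(* The second term on the right integrates against the signed measure
   D xi x = Qtilde_1(xi, x; .) - Q(xi, .), and, like the sum of the two terms,
   could be of the indeterminate form +oo - oo. The last four hypotheses say
   that the right-hand side is meaningful: from the inside out, so are the
   integral against D xi x, the one against L xi, the one against P, and the
   sum. All four hold whenever the first term is finite. *)
Theorem theorem3p1 (d dW : measure_display) (R : realType)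
    (X : localised_borel d R) (W : measurableType dW) (Pr : probability W R)
    (Xi : {RV Pr >-> config X}) (L : R.-ker config X ~> X)
    (Q : R.-pker config X ~> econfig X)
    (Q21 : R.-pker (config X * X * econfig X) ~> econfig X)
    (h : config X * econfig X * X * econfig X -> R)
    (P := distribution Pr Xi)
    (PQ := semidirect P Q)
    (f := fun (xi : config X) (x : X) (s : econfig X) =>
      \int[Q21 (xi, x, s)]_s2 (h (xi, s, x, s2))%:E)
    (D := fun (xi : config X) (x : X) =>
      cdiff (split_law1 Q xi x) (kprob Q xi)) :
  positive_void_probabilities Xi ->
  is_papangelou Xi L ->
  is_edge_kernel Q ->
  is_split_disintegration Q Q21 ->
  measurable_fun setT h -> (forall u, (0 <= h u)%R) ->
  {ae P, forall xi, {ae L xi, forall x,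
    charge_integral_defined (D xi x) (f xi x)}} ->
  {ae P, forall xi,
    integral_defined (L xi) (fun x => charge_integral (D xi x) (f xi x))} ->
  integral_defined P
    (fun xi => \int[L xi]_x charge_integral (D xi x) (f xi x)) ->
  (\int[PQ]_z \int[L z.1]_x f z.1 x z.2) +?
    (\int[P]_xi \int[L xi]_x charge_integral (D xi x) (f xi x)) ->
  \int[PQ]_z \int[config_measure z.1]_x
    (h (del_point z.1 x,
        econfig_restr z.2 (pairs (del_point z.1 x)),
        x,
        econfig_restr z.2 (star (del_point z.1 x) x)))%:E =
  \int[PQ]_z \int[L z.1]_x f z.1 x z.2 +
  \int[P]_xi \int[L xi]_x charge_integral (D xi x) (f xi x).
Proof.
move=> _ papL edgeQ disQ mh h0 _ _ _.
have [K [LK GNZ]] := papangelou_version papL.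
have [C CE] := config_kernel X.
pose F := split_mean Q21 h.
have F0 z : 0 <= F z by exact: split_mean_ge0.
have mF : measurable_fun setT F by exact: measurable_split_mean.
pose A (z : config X * X) := \int[split_law1 Q z.1 z.2]_s F (z, s).
have A0 z : 0 <= A z by exact: integral_ge0.
have mA : measurable_fun setT A by exact: measurable_integral_split_law1.
pose B (z : config X * X) := \int[Q z.1]_s F (z, s).
have B0 z : 0 <= B z by exact: integral_ge0.
have mB : measurable_fun setT B.
  exact: (measurable_fun_integral_kprecomp Q measurable_fst F0 mF).
have intLK xi (g : X -> \bar R) :
    (forall U, measurable U -> L xi U = K xi U) ->
    \int[L xi]_x g x = \int[K xi]_x g x.
  by move=> LKxi; apply: eq_measure_integral => U mU _; exact: LKxi.
have intK (G : config X * X -> \bar R) : (forall z, 0 <= G z) ->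
    measurable_fun setT G ->
    measurable_fun setT (fun xi => \int[K xi]_x G (xi, x)).
  by move=> *; exact: measurable_fun_integral_sfinite_kernel.
have intK0 (G : config X * X -> \bar R) : (forall z, 0 <= G z) ->
    forall xi, 0 <= \int[K xi]_x G (xi, x).
  by move=> G0 xi; exact: integral_ge0.
have LHS : \int[PQ]_z \int[config_measure z.1]_x
    (h (del_point z.1 x, econfig_restr z.2 (pairs (del_point z.1 x)), x,
        econfig_restr z.2 (star (del_point z.1 x) x)))%:E =
    \int[P]_xi \int[K xi]_x A (xi, x).
  rewrite -GNZ//.
  pose H (z : (config X * econfig X) * X) : \bar R :=
    (h (del_point z.1.1 z.2, econfig_restr z.1.2 (pairs (del_point z.1.1 z.2)),
      z.2, econfig_restr z.1.2 (star (del_point z.1.1 z.2) z.2)))%:E.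
  have H0 z : 0 <= H z by rewrite lee_fin.
  have mH : measurable_fun setT H by exact: measurable_split_integrand.
  transitivity (\int[PQ]_z \int[C z.1]_x H (z, x)).
    apply: eq_integral => z _; apply: eq_measure_integral => U mU _.
    by rewrite CE.
  rewrite (@integral_disintegration _ _ _ _ _ _ P Q)//; last 2 first.
  - by move=> z; exact: integral_ge0.
  - exact: (measurable_fun_integral_kprecomp C measurable_fst H0 mH).
  apply: eq_integral => xi _ /=.
  (* The s-finite kernel [C] stands in for [config_measure], so that the sum over points and the
     integral over edges can be exchanged. *)
  rewrite (@kernel_Fubini _ _ _ _ _ _ _ _ _ Q C xi xi
    (fun z => H (xi, z.1, z.2)))//; last first.
    apply: (measurableT_comp mH); apply: measurable_fun_pair => //.
    exact: measurable_fun_pair.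
  transitivity (\int[config_measure xi]_x \int[Q xi]_s H (xi, s, x)).
    by apply: eq_measure_integral => U mU _; rewrite CE.
  apply: ae_integral_eq; apply: filterS (config_ae xi) => x xix.
  exact: integral_split_integrand.
have RHS : \int[PQ]_z \int[L z.1]_x f z.1 x z.2 =
    \int[P]_xi \int[K xi]_x B (xi, x).
  transitivity (\int[PQ]_z \int[K z.1]_x F (z.1, x, z.2)).
    apply: ae_integral_eq; have := @ae_semidirect _ _ _ _ _ P Q _ LK.
    by apply: filterS => z LKz; rewrite intLK.
  have mF' : measurable_fun setT
      (fun z : (config X * econfig X) * X => F (z.1.1, z.2, z.1.2)).
    apply: (measurableT_comp mF); apply: measurable_fun_pair.
      by apply: measurable_fun_pair => //; exact: measurableT_comp.
    exact: measurableT_comp.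
  pose G (z : config X * econfig X) := \int[K z.1]_x F (z.1, x, z.2).
  have G0 z : 0 <= G z by exact: integral_ge0.
  have mG : measurable_fun setT G.
    exact: (measurable_fun_integral_kprecomp K measurable_fst (fun=> F0 _) mF').
  rewrite (@integral_disintegration _ _ _ _ _ _ P Q G _ G0 mG); last first.
    by move=> U mU.
  apply: eq_integral => xi _ /=.
  apply: (@kernel_Fubini _ _ _ _ _ _ _ _ _ Q K xi xi
    (fun z => F (xi, z.2, z.1))) => //.
  apply: (measurableT_comp mF); apply: measurable_fun_pair => //.
  exact: measurable_fun_pair.
rewrite LHS RHS => bc; apply: eq_adde_of_sube bc.
- by apply: integral_ge0 => xi _; exact: intK0.
- by apply: integral_ge0 => xi _; exact: intK0.
(* Differences are split first under [P], then under [K xi], and finally for the signed measure. At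
   each level, finiteness of one outer integral gives finiteness of the corresponding inner one
   almost everywhere. *)
apply: ge0_integralB_ae.
- exact: intK.
- exact: intK.
- exact: intK0.
- exact: intK0.
apply: filterS LK => xi LKxi AB; rewrite intLK//.
apply: ge0_integralB_ae AB => //.
- exact: measurableT_comp mA _.
- exact: measurableT_comp mB _.
apply: aeW => x AB.
have mFx : measurable_fun setT (fun s => F (xi, x, s)).
  exact: (measurableT_comp mF (pair1_measurable _)).
have BE : B (xi, x) = \int[kprob Q xi]_s F (xi, x, s).
  by apply: eq_measure_integral.
rewrite BE in AB *.
exact: (charge_integral_cdiff mFx (fun=> F0 _) AB).
Qed.
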